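(* Let $P$ be a real polynomial, let $d=\deg P$, and let $w\not\equiv 0$ be an entire solution of $w''+Pw=0$ on $\mathbb{C}$ all of whose roots are real. Then: (a) If $d\equiv 0 \pmod 4$, then the set of roots of $w$ is either finite, or unbounded both from above and from below as a subset of the real axis. (b) If $d$ is odd, then the roots of $w$ lie on a ray, and $w$ has infinitely many roots.
   Context: The differential equation $w''+Pw=0$ is considered in the complex plane, where $P$ is a polynomial in the independent complex variable $z$; every solution is an entire function. A polynomial is called real if all its coefficients are real. ''Roots'' of $w$ means the zeros of $w$ in $\mathbb{C}$. A ray here is a closed half-line of the real axis, that is, a set of the form $[c,+\infty)$ or $(-\infty,c]$ with $c\in\mathbb{R}$. *)

(* Defs.v *)
From HB Require Import structures.
From mathcomp Require Import all_boot all_order all_algebra.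
From mathcomp Require Import complex.
From mathcomp Require Import all_classical all_reals all_analysis.

Set Implicit Arguments.
Unset Strict Implicit.
Unset Printing Implicit Defensive.

Import Order.TTheory GRing.Theory Num.Theory.
Import numFieldNormedType.Exports.

Local Open Scope classical_set_scope.
Local Open Scope ring_scope.
Local Open Scope complex_scope.

(* R[i], bundled as a numFieldType so that it is a normed module over itself;
   [derivable f z 1] and [derive1 f z] then speak of the complex derivative. *)
Definition cplx (R : realType) : numFieldType := R[i].

Definition entire (R : realType) (f : cplx R -> cplx R) : Prop :=
  forall z : cplx R, derivable f z 1.

(* [derive1] is total, with an unspecified value where the limit does not
   exist, so the existence of w' and w'' is required explicitly. *)
Definition entire_solution (R : realType) (P : {poly cplx R})
    (w : cplx R -> cplx R) : Prop :=
  [/\ entire w, entire (derive1 w)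
    & forall z : cplx R, derive1n 2 w z + P.[z] * w z = 0].

Definition real_poly (R : realType) (P : {poly cplx R}) : Prop :=
  P \is a polyOver Num.real.

(* The zero polynomial gets degree 0. *)
Definition poly_degree (R : realType) (P : {poly cplx R}) : nat := (size P).-1.

Definition root_set (R : realType) (w : cplx R -> cplx R) : set (cplx R) :=
  [set z | w z = 0].

(* The part of A lying on the real axis, as a set of real numbers. *)
Definition real_trace (R : realType) (A : set (cplx R)) : set R :=
  [set x : R | A x%:C].

Definition is_ray (R : realType) (A : set (cplx R)) : Prop :=
  exists c : R, A = real_complex R @` `[c, +oo[ \/
                A = real_complex R @` `]-oo, c].

(* Main.v *)
Require Import Defs.
From mathcomp Require Import all_boot all_order all_algebra.
From mathcomp Require Import complex polyrcf.
From mathcomp Require Import all_classical all_reals all_analysis.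
From mathcomp Require Import ring lra.

Set Implicit Arguments.
Unset Strict Implicit.
Unset Printing Implicit Defensive.

Import Order.TTheory GRing.Theory Num.Theory.
Import numFieldNormedType.Exports.

Local Open Scope classical_set_scope.
Local Open Scope ring_scope.

(** A solution w with a zero is, up to a constant, real on the real axis; a
    solution without zeros is handled through its logarithmic derivative.

    Suppose first that w has a zero, which is then a real number x0. The
    imaginary part of w / w'(x0) solves on the real axis the same real equation
    with vanishing initial data, hence is zero ([real_solution]). So the zeros of
    w are those of a real solution f of f'' + q f = 0, where q is the restriction
    of P, and only the sign of q near the two ends of the axis matters: where q
    stays above a positive constant f oscillates ([oscillation]); where q <= 0
    it has at most one zero ([nonoscillation]). For even degree the two ends have
    the same sign, for odd degree they have opposite signs.

    Suppose now that w has no zero and that d is odd. Then u = w' / w is entire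
    and satisfies the Riccati equation u' = - (P + u^2). A value of u that is
    large compared with the square root of P is shortly followed by a pole, as
    for u' = - u^2 ([riccati_blowup]); hence |u|^2 = O(|z|^d)
    ([riccati_growth]). The Cauchy estimate on a disc of radius |z| / 2 then
    makes u' small compared with P ([riccati_asymptotics]), so that u^2 behaves
    like - a z^d at infinity, a being the leading coefficient. As an odd power
    of z has no continuous square root near infinity, this is impossible
    ([riccati_odd]).

    The complex analysis needed is elementary: maxima of continuous functions on
    discs, the mean value inequality, and a Cauchy estimate for the first
    derivative ([cauchy_estimate]) in which finite averages over points of a
    circle replace contour integrals. *)

(** * The real-valued modulus *)

(** The norm of [cplx R] takes its values in [cplx R]; estimates are carried out
    in [R], where the order is total and real analysis is available. *)
Definition modulus (R : realType) (z : cplx R) : R := complex.Re `|z|.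

Section modulus_theory.
Variable R : realType.
Local Notation C := (cplx R).
Implicit Types z a b : C.

Lemma normE z : `|z| = (modulus z)%:C%C.
Proof. by case: z. Qed.

Lemma modulus_ge0 z : 0 <= modulus z.
Proof. by have := normr_ge0 z; rewrite normE ler0c. Qed.

Lemma modulusM a b : modulus (a * b) = modulus a * modulus b.
Proof. exact: (ComplexField.Normc.normcM a b). Qed.

Lemma modulusV z : modulus z^-1 = (modulus z)^-1.
Proof. exact: (ComplexField.Normc.normcV z). Qed.

Lemma modulusD a b : modulus (a + b) <= modulus a + modulus b.
Proof. by rewrite -lecR rmorphD /= -!normE; apply: ler_normD. Qed.

Lemma modulusN z : modulus (- z) = modulus z.
Proof. by rewrite /modulus normrN. Qed.

Lemma modulusB a b : modulus (a - b) <= modulus a + modulus b.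
Proof. by rewrite -(modulusN b) modulusD. Qed.

Lemma modulus_distC a b : modulus (a - b) = modulus (b - a).
Proof. by rewrite -modulusN opprB. Qed.

Lemma modulus0 : modulus (0 : C) = 0.
Proof. by rewrite /modulus normr0. Qed.

Lemma modulus1 : modulus (1 : C) = 1.
Proof. by rewrite /modulus normr1. Qed.

Lemma modulusX z n : modulus (z ^+ n) = modulus z ^+ n.
Proof. by elim: n => [|n IH]; rewrite ?expr0 ?modulus1 // !exprS modulusM IH.
Qed.

Lemma modulus_eq0 z : (modulus z == 0) = (z == 0).
Proof. by rewrite -[RHS]normr_eq0 normE -(inj_eq (@complexI R)). Qed.

Lemma modulus_gt0 z : (0 < modulus z) = (z != 0).
Proof. by rewrite lt_def modulus_eq0 modulus_ge0 andbT. Qed.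

Lemma modulus_real (x : R) : modulus (x%:C%C : C) = `|x|.
Proof. by rewrite /modulus /= expr0n /= addr0 sqrtr_sqr. Qed.

Lemma modulus_sum n (F : 'I_n -> C) :
  modulus (\sum_i F i) <= \sum_i modulus (F i).
Proof.
elim/big_ind2 : _ => [|x a y b xa yb|//]; first by rewrite modulus0.
exact: le_trans (modulusD _ _) (lerD xa yb).
Qed.

Lemma sqr_modulus z : modulus z ^+ 2 = complex.Re z ^+ 2 + complex.Im z ^+ 2.
Proof. by case: z => x y; rewrite /modulus /= sqr_sqrtr// addr_ge0 ?sqr_ge0.
Qed.

Lemma Re_le_modulus z : `|complex.Re z| <= modulus z.
Proof.
rewrite -(@ler_pXn2r _ 2) ?nnegrE ?modulus_ge0 //.
by rewrite real_normK ?num_real // sqr_modulus lerDl sqr_ge0.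
Qed.

Lemma ltc_modulus z (e : R) : (`|z| < e%:C%C) = (modulus z < e).
Proof. by rewrite normE ltcR. Qed.

Lemma ReD a b : complex.Re (a + b) = complex.Re a + complex.Re b.
Proof. by case: a; case: b. Qed.
Lemma ReN a : complex.Re (- a) = - complex.Re a.
Proof. by case: a. Qed.
Lemma ReB a b : complex.Re (a - b) = complex.Re a - complex.Re b.
Proof. by rewrite ReD ReN. Qed.
Lemma ReZ (x : R) a : complex.Re (x%:C%C * a) = x * complex.Re a.
Proof. by case: a => s t /=; rewrite mul0r subr0. Qed.

End modulus_theory.

(** * Derivatives along lines *)

Section linear_approximation.
Variable R : realType.
Local Notation C := (cplx R).

Lemma is_derive_approx (f : C -> C) (z d : C) : is_derive z 1 f d ->
  forall e : R, 0 < e -> exists2 r : R, 0 < r & forall k : C, modulus k < r ->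
    modulus (f (z + k) - f z - d * k) <= e * modulus k.
Proof.
case=> fz fd e e0.
have fl : (fun h : C => h^-1 *: (f (h *: 1 + z) - f z)) @ 0^' --> d.
  by rewrite -fd; move: fz; rewrite /derivable /derive /=.
have e0' : 0 < (e%:C%C : C) by rewrite ltcR.
move/cvgrPdist_le : fl => /(_ _ e0').
rewrite /= => -[r /= r0 H].
exists (complex.Re r).
  by move: r0; rewrite ltcE => /andP[].
move=> k kr.
have [->|k0] := eqVneq k 0; first by rewrite addr0 subrr mulr0 subrr modulus0
  mulr0.
have := H k; rewrite /= sub0r normrN.
have rE : r = ((complex.Re r)%:C)%C.
  by move: r0; rewrite ltcE => /andP[/eqP/= i0 _]; case: (r) i0 => a b /= ->.
rewrite rE ltc_modulus => /(_ kr k0).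
rewrite normE lecR => {}H.
have -> : f (z + k) - f z - d * k = -
  (k * (d - k^-1 *: (f (k *: 1 + z) - f z))).
  rewrite /GRing.scale /= mulr1 [k + z]addrC mulrBr mulrA mulfV //.
  by rewrite mul1r [k * d]mulrC opprB.
by rewrite modulusN modulusM mulrC ler_wpM2r // modulus_ge0.
Qed.

Lemma approx_is_derive (f : R -> R) (t d : R) :
  (forall e : R, 0 < e -> exists2 r : R, 0 < r & forall k : R, `|k| < r ->
    `|f (t + k) - f t - d * k| <= e * `|k|) -> is_derive t 1 f d.
Proof.
move=> H.
have : (fun h : R => h^-1 *: (f (h *: 1 + t) - f t)) @ 0^' --> d.
  apply/cvgrPdist_le => e e0; have [r r0 Hr] := H e e0.
  exists r => //= k /=; rewrite sub0r normrN => kr k0.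
  have -> : d - k^-1 *: (f (k *: 1 + t) - f t) =
    - (k^-1 * (f (t + k) - f t - d * k)).
    rewrite /GRing.scale /= mulr1 [k + t]addrC; field.
    exact: k0.
  rewrite normrN normrM normfV mulrC ler_pdivrMr ?normr_gt0 //; exact: Hr.
move=> cvd; apply: DeriveDef; first by apply/cvg_ex; exists d.
exact: cvg_lim cvd.
Qed.

(** Reduces estimates on a complex function to real calculus: one real-linear
    functional of it is followed along one line at a time. *)
Lemma is_derive_line (f : C -> C) (z0 h c d : C) (t : R) :
  is_derive (z0 + t%:C%C * h) 1 f d ->
  is_derive t 1 (fun s : R => complex.Re (c * f (z0 + s%:C%C * h)))
    (complex.Re (c * (d * h))).
Proof.
move=> fd; apply: approx_is_derive => e e0.
have K0 : 0 < modulus c * modulus h + 1.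
  by rewrite ltr_wpDl // mulr_ge0 // modulus_ge0.
have e'0 : 0 < e / (modulus c * modulus h + 1) by rewrite divr_gt0.
have [r r0 Hr] := is_derive_approx fd e'0.
have M0 : 0 < modulus h + 1 by rewrite ltr_wpDl // modulus_ge0.
exists (r / (modulus h + 1)); first by rewrite divr_gt0.
move=> k; rewrite ltr_pdivlMr // => kr.
have khr : modulus (k%:C%C * h) < r.
  rewrite modulusM modulus_real; apply: le_lt_trans kr.
  by rewrite ler_wpM2l // lerDl.
have zE : z0 + (t + k)%:C%C * h = z0 + t%:C%C * h + k%:C%C * h.
  by rewrite rmorphD mulrDl addrA.
have := Hr _ khr; rewrite -zE => Hk.
have -> : complex.Re (c * f (z0 + (t + k)%:C%C * h)) - complex.Re
  (c * f (z0 + t%:C%C * h))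
  - complex.Re (c * (d * h)) * k = complex.Re (c *
  (f (z0 + (t + k)%:C%C * h) - f (z0 + t%:C%C * h) - d * (k%:C%C * h))).
  by rewrite !mulrBr !ReB; congr (_ - _ - _); rewrite [LHS]mulrC -ReZ;
    congr complex.Re; ring.
apply: le_trans (Re_le_modulus _) _; rewrite modulusM.
apply: le_trans (ler_wpM2l (modulus_ge0 _) Hk) _.
rewrite modulusM modulus_real.
rewrite [leLHS](_ : _ = e * `|k| *
  (modulus c * modulus h / (modulus c * modulus h + 1))); last by ring.
rewrite ler_piMr ?mulr_ge0 ?(ltW e0) // ler_pdivrMr // mul1r lerDl //.
Qed.
End linear_approximation.

(** * Rules for derivatives of functions given pointwise *)

Section pointwise_derivatives.
Variable K : numFieldType.
Implicit Types (f g : K -> K) (x a b c : K).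

Lemma is_derive_continuous f x a :
  is_derive x 1 f a -> {for x, continuous f}.
Proof. by case=> fx _; exact/differentiable_continuous/derivable1_diffP. Qed.

Lemma is_derive_add f g x a b : is_derive x 1 f a -> is_derive x 1 g b ->
  is_derive x 1 (fun y => f y + g y) (a + b).
Proof. by move=> fx gx; exact: is_deriveD. Qed.

Lemma is_derive_sub f g x a b : is_derive x 1 f a -> is_derive x 1 g b ->
  is_derive x 1 (fun y => f y - g y) (a - b).
Proof. by move=> fx gx; exact: is_deriveB. Qed.

Lemma is_derive_opp f x a : is_derive x 1 f a ->
  is_derive x 1 (fun y => - f y) (- a).
Proof. by move=> fx; exact: is_deriveN. Qed.

Lemma is_derive_mul f g x a b : is_derive x 1 f a -> is_derive x 1 g b ->
  is_derive x 1 (fun y => f y * g y) (a * g x + f x * b).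
Proof.
move=> fx gx; have -> : a * g x + f x * b = f x *: (b : K^o) + g x *: (a : K^o).
  by rewrite addrC [g x *: _]mulrC.
exact: (@is_deriveM K K f g x 1 _ _ fx gx).
Qed.

Lemma is_derive_mull f x c a : is_derive x 1 f a ->
  is_derive x 1 (fun y => c * f y) (c * a).
Proof.
move=> fx; apply: (is_derive_eq (is_derive_mul (is_derive_cst (c : K^o) x 1)
  fx)).
by rewrite mul0r add0r.
Qed.

Lemma is_derive_inv f x a : f x != 0 -> is_derive x 1 f a ->
  is_derive x 1 (fun y => (f y)^-1) (- a / f x ^+ 2).
Proof.
move=> fx0 fx; have [fd fE] := fx.
apply: DeriveDef; first exact: derivableV.
by rewrite deriveV // fE /GRing.scale /= mulNr mulrC mulNr.
Qed.

Lemma is_derive_sumf n (F : 'I_n -> K -> K) x (a : 'I_n -> K) :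
  (forall i, is_derive x 1 (F i) (a i)) ->
  is_derive x 1 (fun y => \sum_i F i y) (\sum_i a i).
Proof.
move=> Fx; have -> : (fun y => \sum_i F i y) = \sum_i F i.
  by apply/funext => y; rewrite fct_sumE.
exact: is_derive_sum.
Qed.

Lemma is_derive_compose f g x a b : is_derive (g x) 1 f a ->
  is_derive x 1 g b -> is_derive x 1 (fun y => f (g y)) (a * b).
Proof.
move=> [fd <-] [gd gE].
have /derivable1_diffP df := fd; have /derivable1_diffP dg := gd.
have -> : (fun y => f (g y)) = f \o g by [].
apply: DeriveDef; first exact/derivable1_diffP/differentiable_comp.
have fE : 'D_1 f (g x) = 'd f (g x) 1 by rewrite deriveE.
rewrite deriveE; last exact/differentiable_comp.
have dgE : 'd g x 1 = b by rewrite -deriveE.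
rewrite diff_comp //= dgE -[X in 'd _ _ X = _]mulr1 [LHS]linearZ fE.
exact (mulrC b _).
Qed.

Lemma is_derive_affine f x c b a : is_derive (c + x * b) 1 f a ->
  is_derive x 1 (fun y => f (c + y * b)) (a * b).
Proof.
move=> fx; apply: (@is_derive_compose f (fun y => c + y * b) x a b fx).
apply: (is_derive_eq (is_derive_add (is_derive_cst (c : K^o) x 1)
  (is_derive_mul (is_derive_id (x : K^o) 1) (is_derive_cst (b : K^o) x 1)))).
by rewrite add0r mul1r mulr0 addr0.
Qed.

Lemma is_derive_horner (p : {poly K}) x :
  is_derive x 1 (fun y => p.[y]) p^`().[x].
Proof.
elim/poly_ind: p => [|p c IH].
  have -> : (fun y => (0 : {poly K}).[y]) = cst 0 by apply/funext => y;
    rewrite horner0.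
  by rewrite deriv0 horner0; exact: is_derive_cst.
have -> : (fun y => (p * 'X + c%:P).[y]) = (fun y => p.[y] * y + c).
  by apply/funext => y; rewrite !hornerE.
apply: (is_derive_eq (is_derive_add (is_derive_mul IH (is_derive_id (x : K^o)
  1))
  (is_derive_cst (c : K^o) x 1))).
by rewrite derivD derivM derivX derivC !hornerE.
Qed.

End pointwise_derivatives.

(** * Mean value inequalities *)

Section mean_value.
Variable R : realType.
Local Notation C := (cplx R).

Lemma real_mean_value (f df : R -> R) (a b : R) : a < b ->
  (forall x : R, is_derive x 1 f (df x)) ->
  exists2 c, a < c < b & f b - f a = df c * (b - a).
Proof.
move=> ab fd; have [|c cab E] := @MVT R f df a b ab (fun x _ => fd x).
  by apply: continuous_subspaceT => x; exact: is_derive_continuous (fd x).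
by exists c => //; move: cab; rewrite in_itv.
Qed.

(** Projecting the increment on its own direction reduces the complex case to
    the real mean value theorem. *)
Lemma mean_value_inequality (f df : C -> C) (z0 h : C) (B : R) :
  (forall z : C, is_derive z 1 f (df z)) ->
  (forall t : R, 0 < t < 1 -> modulus (df (z0 + t%:C%C * h)) <= B) ->
  modulus (f (z0 + h) - f z0) <= B * modulus h.
Proof.
move=> fd dfB; set D := f (z0 + h) - f z0.
have B0 : 0 <= B.
  by apply: le_trans (modulus_ge0 _) (dfB 2^-1 _); apply/andP; split; lra.
have [->|D0] := eqVneq D 0; first by rewrite modulus0 mulr_ge0 ?modulus_ge0.
pose c : C := conjc D.
have [t t01] := real_mean_value ltr01 (fun t => is_derive_line c
  (fd (z0 + t%:C%C * h))).
rewrite subr0 mulr1 -ReB -mulrBr rmorph1 rmorph0 mul1r mul0r addr0 -/D.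
have -> : complex.Re (c * D) = modulus D ^+ 2.
  by rewrite sqr_modulus /c; case: D {D0 c} => x y /=; ring.
move=> E.
have : modulus D ^+ 2 <= modulus D * (B * modulus h).
  rewrite E; apply: le_trans (ler_norm _) (le_trans (Re_le_modulus _) _).
  have -> : modulus D = modulus c by rewrite /c /modulus; case: D {D0 E c} =>
    x y /=; rewrite sqrrN.
  by rewrite !modulusM ler_wpM2l ?modulus_ge0 // ler_wpM2r ?modulus_ge0 // dfB.
by rewrite expr2 ler_pM2l // modulus_gt0.
Qed.

Lemma taylor_inequality (f df d2f : C -> C) (z0 h : C) (B : R) :
  (forall z : C, is_derive z 1 f (df z)) -> (forall z : C, is_derive z 1 df
    (d2f z)) ->
  (forall t : R, 0 < t < 1 -> modulus (d2f (z0 + t%:C%C * h)) <= B) ->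
  modulus (f (z0 + h) - f z0 - df z0 * h) <= B * modulus h ^+ 2.
Proof.
move=> fd dfd d2B.
have B0 : 0 <= B.
  by apply: le_trans (modulus_ge0 _) (d2B 2^-1 _); apply/andP; split; lra.
have gd (z : C) : is_derive z 1 (fun y => f y - df z0 * y) (df z - df z0).
  apply: (is_derive_eq (is_derive_sub (fd z) (is_derive_mull (df z0)
    (is_derive_id (z : C^o) 1)))).
  by rewrite mulr1.
have := @mean_value_inequality _ _ z0 h (B * modulus h) gd.
have -> : f (z0 + h) - df z0 * (z0 + h) - (f z0 - df z0 * z0) =
  f (z0 + h) - f z0 - df z0 * h by ring.
rewrite expr2 mulrA; apply=> t /andP[t0 t1].
apply: le_trans (@mean_value_inequality _ _ z0 (t%:C%C * h) B dfd _) _.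
  move=> s /andP[s0 s1]; rewrite mulrA -rmorphM /=; apply: d2B.
  by rewrite mulr_gt0 //= mulr_ilt1 // ltW.
rewrite modulusM modulus_real (ger0_norm (ltW t0)) ler_wpM2l //.
by rewrite ler_piMl ?modulus_ge0 ?(ltW t1).
Qed.

End mean_value.

(** * Compactness of closed discs *)

Section compactness.
Variable R : realType.
Local Notation C := (cplx R).

Lemma modulus_lip (a b : C) : `|modulus a - modulus b| <= modulus (a - b).
Proof.
have := modulusD (a - b) b; have := modulusD (b - a) a.
by rewrite !subrK modulus_distC ler_norml => ? ?; apply/andP; split; lra.
Qed.

Lemma continuous_modulus : continuous (@modulus R).
Proof.
move=> z; have F : Filter (nbhs z) by exact: nbhs_filter.
apply/(@cvgrPdist_lt R R^o C (nbhs z) F) => e e0.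
apply/nbhs_ballP; exists (e%:C%C : C) => /=; first by rewrite ltcR.
move=> y; rewrite /ball /= ltc_modulus => ye.
exact: le_lt_trans (modulus_lip _ _) ye.
Qed.

Definition disc (z0 : C) (r : R) : set C := [set z | modulus (z - z0) <= r].

Lemma closed_disc z0 r : closed (disc z0 r).
Proof.
have -> : disc z0 r = (fun z => modulus (z - z0)) @^-1` [set x | x <= r] by [].
apply: closed_comp; last exact: closed_le.
move=> z _; apply: (@continuous_comp _ _ _ (fun z => z - z0) (@modulus R)).
  exact: is_derive_continuous (is_derive_sub (is_derive_id (z : C^o) 1)
    (is_derive_cst (z0 : C^o) z 1)).
exact: continuous_modulus.
Qed.

Lemma compact_disc z0 r : compact (disc z0 r).
Proof.
pose g (x : R * R) : C := z0 + (x.1 +i* x.2)%C.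
have cg : continuous g.
  move=> x; apply/cvgrPdist_lt => e; case: e => e e' /=.
  rewrite ltcE /= => /andP[/eqP -> e0].
  have e2 : 0 < e / 2 by rewrite divr_gt0.
  have F : Filter (nbhs x) by exact: nbhs_filter.
  have fst_x : (fun y : R * R => y.1) @ nbhs x --> x.1 by exact: cvg_fst.
  have snd_x : (fun y : R * R => y.2) @ nbhs x --> x.2 by exact: cvg_snd.
  have H1 : \forall y \near x, `|x.1 - y.1| < e / 2.
    by move/cvgr_dist_lt : fst_x; apply.
  have H2 : \forall y \near x, `|x.2 - y.2| < e / 2.
    by move/cvgr_dist_lt : snd_x; apply.
  apply: filterS2 H1 H2 => y y1 y2.
  rewrite ltc_modulus /g opprD addrACA subrr add0r.
  have -> : ((x.1 +i* x.2) - (y.1 +i* y.2))%C = (x.1 - y.1)%:C%C + 'i%C *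
    (x.2 - y.2)%:C%C :> C.
    by apply/eqP; rewrite eq_complex /=; apply/andP; split; apply/eqP; ring.
  apply: le_lt_trans (modulusD _ _) _.
  rewrite modulusM !modulus_real.
  have -> : modulus ('i%C : C) = 1 by rewrite /modulus /= expr0n /=
    expr1n add0r sqrtr1.
  by rewrite mul1r (splitr e) ltrD.
apply: (@subclosed_compact _ _ (g @` (`[- r, r] `*` `[- r, r]))).
- exact: closed_disc.
- apply: continuous_compact; first exact: continuous_subspaceT.
  by apply: compact_setX; exact: segment_compact.
move=> z zr; exists (complex.Re (z - z0), complex.Im (z - z0)).
  have := Re_le_modulus (z - z0).
  have : `|complex.Im (z - z0)| <= modulus (z - z0).
    rewrite -(@ler_pXn2r _ 2) ?nnegrE ?modulus_ge0 //.
    by rewrite real_normK ?num_real // sqr_modulus lerDr sqr_ge0.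
  move=> /le_trans /(_ zr) + /le_trans /(_ zr).
  by rewrite !ler_norml /= !in_itv.
rewrite /g /= -[RHS](subrK z0) addrC; congr (_ + _).
by case: (z - z0).
Qed.

Lemma disc_EVT (f : C -> R) z0 r : 0 <= r -> continuous f ->
  exists2 c, modulus (c - z0) <= r & forall z, modulus (z - z0) <= r -> f z <=
    f c.
Proof.
move=> r0 cf.
have [||c] := @compact_EVT_max _ R f (disc z0 r) _ (@compact_disc z0 r).
- by exists z0; rewrite /disc /= subrr modulus0.
- exact: continuous_subspaceT.
rewrite inE => cr H; exists c => // z zr; apply: H; by rewrite inE.
Qed.

Lemma bounded_on_disc (f : C -> C) z0 r : continuous f ->
  exists2 B, 0 <= B & forall z, modulus (z - z0) <= r -> modulus (f z) <= B.
Proof.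
move=> cf; have [r0|r0] := leP 0 r; last first.
  exists 0 => // z zr; have := modulus_ge0 (z - z0).
  by rewrite leNgt (le_lt_trans zr).
have [|c _ H] := @disc_EVT (fun z => modulus (f z)) z0 r r0.
  move=> z; apply: (@continuous_comp _ _ _ f (@modulus R)); first exact: cf.
  exact: continuous_modulus.
by exists (modulus (f c)) => //; exact: modulus_ge0.
Qed.

End compactness.

(** * A Cauchy estimate without integrals *)

Section cauchy.
Variable R : realType.
Local Notation C := (cplx R).

Lemma unimodular_near_1 (e : R) : 0 < e ->
  exists om : C, modulus om = 1 /\ 0 < modulus (om - 1) <= e.
Proof.
move=> e0; have [t t0 ->] : exists2 t, 0 < t & e = 2 * t.
  by exists (e / 2); [rewrite divr_gt0|field].
have d0 : 1 + t ^+ 2 != 0 by rewrite gt_eqF // ltr_wpDr ?sqr_ge0.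
(* (1 + i t) / (1 - i t): a point of the unit circle, within [2 t] of 1 *)
pose om : C := ((1 - t ^+ 2) / (1 + t ^+ 2) +i* (2 * t / (1 + t ^+ 2)))%C.
have om1 : om != 1.
  rewrite eq_complex /= negb_and mulf_eq0 invr_eq0 (negbTE d0) orbF.
  by rewrite (gt_eqF (mulr_gt0 _ t0)) ?orbT.
exists om; split; last (apply/andP; split); first 2 last.
- rewrite -(@ler_pXn2r _ 2) ?nnegrE ?modulus_ge0 ?mulr_ge0 ?(ltW t0) //
  sqr_modulus /=.
  have -> : ((1 - t ^+ 2) / (1 + t ^+ 2) + - 1) ^+ 2
      + (2 * t / (1 + t ^+ 2) + - 0) ^+ 2 = (2 * t) ^+ 2 / (1 + t ^+ 2).
    by field.
  by rewrite ler_pdivrMr ?ler_peMr ?sqr_ge0 ?lerDl ?sqr_ge0 // ltr_wpDr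
    ?sqr_ge0.
- apply/eqP; rewrite -(@eqrXn2 _ 2) ?modulus_ge0 //.
  by rewrite sqr_modulus /=; apply/eqP; field.
- by rewrite modulus_gt0 subr_eq0.
Qed.

(** The sum is a Riemann sum for the integral of a derivative around the circle
    of radius [|ze|]; it telescopes up to a quadratic error, wherever the
    (generally not closed) chain of points ends. *)
Lemma circle_sum_derivative (g g1 g2 : C -> C) (z0 om ze : C) (N : nat)
    (r B1 B2 : R) :
  (forall z : C, is_derive z 1 g (g1 z)) ->
  (forall z : C, is_derive z 1 g1 (g2 z)) ->
  (forall z, modulus (z - z0) <= r -> modulus (g1 z) <= B1) ->
  (forall z, modulus (z - z0) <= r -> modulus (g2 z) <= B2) ->
  0 <= B2 -> modulus om = 1 -> ze != 0 -> modulus ze <= r ->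
  modulus (\sum_(k < N) g1 (z0 + ze * om ^+ k) * om ^+ k) * modulus (om - 1)
    <= 2 * B1 + N%:R * (B2 * r * modulus (om - 1) ^+ 2).
Proof.
move=> gd g1d g1B g2B B20 om1 ze0 zer.
have omX (k : nat) : modulus (om ^+ k) = 1 by rewrite modulusX om1 expr1n.
have chord (k : nat) (a : C) (t : R) : modulus a = 1 -> 0 < t < 1 ->
    modulus (z0 + ze * om ^+ k + t%:C%C * (ze * om ^+ k * (a - 1)) - z0) <= r.
  move=> a1 /andP[t0 t1]; apply: le_trans zer.
  have -> : z0 + ze * om ^+ k + t%:C%C * (ze * om ^+ k * (a - 1)) - z0
    = ze * om ^+ k * ((1 - t)%:C%C + t%:C%C * a) by rewrite rmorphB rmorph1;
      ring.
  rewrite !modulusM omX mulr1 ler_piMr ?modulus_ge0 //.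
  apply: le_trans (modulusD _ _) _.
  rewrite modulusM !modulus_real a1 !ger0_norm; lra.
pose h (j : nat) := g (z0 + ze * om ^+ j).
have step : forall j : nat, modulus (h j.+1 - h j - g1 (z0 + ze * om ^+ j) *
  (ze * om ^+ j * (om - 1)))
    <= B2 * (modulus ze * modulus (om - 1)) ^+ 2.
  move=> j; have := @taylor_inequality _ g g1 g2 (z0 + ze * om ^+ j)
    (ze * om ^+ j * (om - 1)) B2 gd g1d.
  rewrite !modulusM omX mulr1 /h [om ^+ j.+1]exprSr.
  have -> : z0 + ze * om ^+ j + ze * om ^+ j * (om - 1) =
    z0 + ze * (om ^+ j * om) by ring.
  by apply => t t01; apply: g2B; apply: chord.
have ends : modulus (h N - h 0) <= B1 * (2 * modulus ze).
  have := @mean_value_inequality _ g g1 (z0 + ze) (ze * (om ^+ N - 1)) B1 gd.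
  have -> : z0 + ze + ze * (om ^+ N - 1) = z0 + ze * om ^+ N by ring.
  rewrite /h expr0 mulr1 => H; apply: le_trans (H _) _.
    by move=> t t01; apply: g1B; have := chord 0 (om ^+ N) t (omX N) t01;
      rewrite expr0 mulr1.
  have B10 : 0 <= B1.
    apply: le_trans (modulus_ge0 _) (g1B z0 _); rewrite subrr modulus0.
    exact: le_trans (modulus_ge0 _) zer.
  rewrite ler_wpM2l // modulusM mulrC ler_wpM2r ?modulus_ge0 //.
  by apply: le_trans (modulusB _ _) _; rewrite omX modulus1.
rewrite -(ler_pM2l (x := modulus ze)) ?modulus_gt0 //.
have -> : modulus ze * (modulus (\sum_(k < N) g1 (z0 + ze * om ^+ k) * om ^+ k)
  * modulus (om - 1))
    = modulus (\sum_(k < N) g1 (z0 + ze * om ^+ k) * (ze * om ^+ k * (om - 1))).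
  rewrite -!modulusM mulr_suml mulr_sumr; congr modulus; apply: eq_bigr => k _;
    ring.
have -> : \sum_(k < N) g1 (z0 + ze * om ^+ k) * (ze * om ^+ k * (om - 1)) =
  h N - h 0 - \sum_(k < N) (h k.+1 - h k - g1 (z0 + ze * om ^+ k) *
    (ze * om ^+ k * (om - 1))).
  rewrite [in RHS]sumrB -(big_mkord xpredT (fun k => h k.+1 - h k)).
  by rewrite telescope_sumr // subKr.
apply: le_trans (modulusB _ _) _.
rewrite mulrDr lerD //; first by have -> : modulus ze * (2 * B1) =
  B1 * (2 * modulus ze) by ring.
apply: le_trans (modulus_sum _) _.
apply: (@le_trans _ _ (\sum_(k < N) B2 * (modulus ze * modulus (om - 1)) ^+ 2)).
  by apply: ler_sum => k _; exact: step.
rewrite sumr_const card_ord -[leLHS]mulr_natl [leRHS]mulrCA ler_wpM2l //.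
rewrite [leLHS](_ : _ = modulus ze * (B2 * modulus ze * modulus (om - 1) ^+
  2)); last by ring.
by rewrite ler_wpM2l ?modulus_ge0 // ler_wpM2r ?sqr_ge0 // ler_wpM2l.
Qed.

(** Averaging over a long, slowly rotating chain of points on a circle plays the
    part of the Cauchy integral: the average of [f1] over circles has derivative
    almost zero in the radius, so stays close to [f1 z0]; integrating once more
    shows that [r * f1 z0] is close to a weighted average of values of [f]. *)
Lemma cauchy_estimate (f f1 f2 f3 : C -> C) (z0 : C) (M r : R) : 0 < r ->
  (forall z : C, is_derive z 1 f (f1 z)) ->
  (forall z : C, is_derive z 1 f1 (f2 z)) ->
  (forall z : C, is_derive z 1 f2 (f3 z)) -> continuous f3 ->
  (forall z, modulus (z - z0) <= r -> modulus (f z) <= M) ->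
  modulus (f1 z0) * r <= 2 * M.
Proof.
move=> r0 fd f1d f2d f3c fM.
have [B1 B10 f2B] : exists2 B, 0 <= B & forall z, modulus (z - z0) <= r ->
  modulus (f2 z) <= B.
  by apply: bounded_on_disc => z; exact: is_derive_continuous (f2d z).
have [B2 B20 f3B] := bounded_on_disc z0 r f3c.
apply/ler_addgt0Pr => e e0.
have d0 : 0 < e / (2 * (B2 * r ^+ 3 + 1)).
  by rewrite divr_gt0 // mulr_gt0 // ltr_wpDl // mulr_ge0 // exprn_ge0 // ltW.
have [om [om1 /andP[del0 del_le]]] := unimodular_near_1 d0.
set del := modulus (om - 1) in del0 del_le.
(* [om] is chosen first, to control the quadratic error of the telescoping sum,
   and [N] next, to make the contribution of the two ends negligible. *)
set X := 4 * B1 * r ^+ 2 / (e * del).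
pose N := (Num.truncn X).+1.
have NX : X < N%:R by exact: truncnS_gt.
have N0 : 0 < N%:R :> R by rewrite ltr0n.
have NC0 : modulus (N%:R : C) = N%:R.
  by rewrite -[N%:R](rmorph_nat (real_complex R)) modulus_real ger0_norm // ltW.
have omX (k : nat) : modulus (om ^+ k) = 1 by rewrite modulusX om1 expr1n.
have om0 : om != 0 by rewrite -modulus_gt0 om1.
(* [T] and [A] are [N] times weighted averages of [f1] and of [f] over the chain;
   the weights are chosen to make [T] the derivative of [A]. *)
pose T (ze : C) := \sum_(k < N) f1 (z0 + ze * om ^+ k).
pose A (ze : C) := \sum_(k < N) (om ^+ k)^-1 * f (z0 + ze * om ^+ k).
have Td (ze : C) : is_derive ze 1 T (\sum_(k < N) f2 (z0 + ze * om ^+ k) * om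
  ^+ k).
  by apply: is_derive_sumf => k; exact: is_derive_affine.
have Ad (ze : C) : is_derive ze 1 A (T ze).
  apply: is_derive_sumf => k.
  apply: (is_derive_eq (is_derive_mull _ (is_derive_affine (fd _)))).
  by rewrite mulrCA mulVf ?mulr1 // expf_neq0.
pose E := (2 * B1 + N%:R * (B2 * r * del ^+ 2)) / del.
have E0 : 0 <= E.
  apply: divr_ge0; last exact: ltW.
  apply: addr_ge0; first exact: mulr_ge0.
  by do 2![apply: mulr_ge0 => //]; rewrite ?sqr_ge0 // mulr_ge0 // ltW.
have T0 : T 0 = N%:R * f1 z0.
  rewrite /T (eq_bigr (fun=> f1 z0)) ?sumr_const ?card_ord ?mulr_natl // => k _.
  by rewrite mul0r addr0.
have Tdrift (ze : C) : modulus ze <= r -> modulus (T ze - N%:R * f1 z0) <=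
  E * r.
  move=> zer; apply: (@le_trans _ _ (E * modulus ze)); last exact: ler_wpM2l.
  have [->|ze0] := eqVneq ze 0; first by rewrite T0 subrr modulus0 mulr0.
  rewrite -T0 -[in T ze](add0r ze); apply: mean_value_inequality Td _ =>
    t /andP[t0 t1].
  rewrite add0r /E ler_pdivlMr //; apply: circle_sum_derivative => //.
    by rewrite mulf_neq0 // -modulus_gt0 modulus_real normr_gt0 gt_eqF.
  rewrite modulusM modulus_real (ger0_norm (ltW t0)); apply: le_trans zer.
  by rewrite ler_piMl ?modulus_ge0 ?(ltW t1).
have rr : modulus (r%:C%C : C) = r by rewrite modulus_real ger0_norm // ltW.
have Adrift : modulus (A r%:C%C - A 0 - N%:R * f1 z0 * r%:C%C) <= E * r * r.
  pose G (ze : C) := A ze - N%:R * f1 z0 * ze.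
  have Gd (ze : C) : is_derive ze 1 G (T ze - N%:R * f1 z0).
    apply: (is_derive_eq (is_derive_sub (Ad ze) (is_derive_mull (N%:R * f1 z0)
      (is_derive_id (ze : C^o) 1)))).
    by rewrite mulr1.
  have := @mean_value_inequality _ G _ 0 r%:C%C (E * r) Gd.
  rewrite rr add0r /G mulr0 subr0 addrAC; apply=> t /andP[t0 t1].
  rewrite add0r; apply: Tdrift; rewrite modulusM rr modulus_real
    (ger0_norm (ltW t0)).
  by rewrite ler_piMl ?(ltW t1) ?(ltW r0).
have AM (ze : C) : modulus ze <= r -> modulus (A ze) <= N%:R * M.
  move=> zer; apply: le_trans (modulus_sum _) _.
  rewrite [N%:R * M](_ : _ = \sum_(k < N) M); last by rewrite sumr_const
    card_ord mulr_natl.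
  apply: ler_sum => k _; rewrite modulusM modulusV omX invr1 mul1r; apply: fM.
  by rewrite addrAC subrr add0r modulusM omX mulr1.
have : N%:R * (modulus (f1 z0) * r) <= N%:R * M + N%:R * M + E * r * r.
  rewrite -NC0 mulrA -modulusM -[in leLHS]rr -modulusM NC0.
  rewrite -[N%:R * f1 z0 * _](subKr (A r%:C%C - A 0)).
  apply: le_trans (modulusB _ _) (lerD (le_trans (modulusB _ _) (lerD _ _))
    Adrift).
    by apply: AM; rewrite rr.
  by apply: AM; rewrite modulus0 ltW.
have E_le : E * r * r <= N%:R * e.
  have -> : E * r * r = X * e / 2 + N%:R * (B2 * r ^+ 3 * del).
    by rewrite /E /X; field; rewrite gt_eqF //= gt_eqF.
  have -> : N%:R * e = N%:R * e / 2 + N%:R * (e / 2) by field.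
  apply: lerD; first by rewrite ler_pM2r ?invr_gt0 // ler_pM2r // ltW.
  rewrite ler_pM2l //; apply: le_trans (ler_wpM2l _ del_le) _.
    by rewrite mulr_ge0 // exprn_ge0 // ltW.
  have Y0 : 0 <= B2 * r ^+ 3 by rewrite mulr_ge0 // exprn_ge0 // ltW.
  have Y1 : 0 < B2 * r ^+ 3 + 1 by rewrite ltr_wpDl.
  have -> : B2 * r ^+ 3 * (e / (2 * (B2 * r ^+ 3 + 1))) =
    (e / 2) * (B2 * r ^+ 3 / (B2 * r ^+ 3 + 1)) by field; rewrite gt_eqF.
  by rewrite ler_piMr ?divr_ge0 ?(ltW e0) // ler_pdivrMr // mul1r lerDl.
move=> H; rewrite -(ler_pM2l N0); apply: le_trans H _.
have -> : N%:R * (2 * M + e) = N%:R * M + N%:R * M + N%:R * e by ring.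
by rewrite lerD2l.
Qed.

End cauchy.

(** * Growth of entire solutions of the Riccati equation *)

Section riccati.
Variable R : realType.
Local Notation C := (cplx R).

(** At a maximum point of [|u| / (1 + |z - z0| |u| / 8)], which is a way of
    minimising [1 / |u| + |z - z0| / 8] without dividing by [u], a step in the
    direction making [u' dz] a positive multiple of [u] would increase the
    function: there [u' = - (p + u ^ 2)] is dominated by [u ^ 2].  So a large
    value of [u] forces a pole nearby. *)
Lemma riccati_blowup (u p : C -> C) (z0 : C) :
  (forall z : C, is_derive z 1 u (- (p z + u z ^+ 2))) ->
  0 < modulus (u z0) ->
  ~ (forall z, modulus (z - z0) <= 8 / modulus (u z0) ->
      modulus (p z) <= modulus (u z0) ^+ 2 / 2).
Proof.
move=> ud; set U := modulus (u z0) => U0 pU.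
pose F (z : C) := modulus (u z) / (1 + modulus (z - z0) * modulus (u z) / 8).
have den0 (z : C) : 0 < 1 + modulus (z - z0) * modulus (u z) / 8.
  by rewrite ltr_wpDr // divr_ge0 // mulr_ge0 ?modulus_ge0.
have cu : continuous (fun z => modulus (u z)).
  move=> z; apply: (@continuous_comp _ _ _ u (@modulus R)).
    exact: is_derive_continuous (ud z).
  exact: continuous_modulus.
have cd : continuous (fun z => modulus (z - z0)).
  move=> z; apply: (@continuous_comp _ _ _ (fun z => z - z0) (@modulus R)).
    exact: is_derive_continuous (is_derive_sub (is_derive_id (z : C^o) 1)
      (is_derive_cst (z0 : C^o) z 1)).
  exact: continuous_modulus.
have cF : continuous F.
  move=> z; have Fz : Filter (nbhs z) by exact: nbhs_filter.
  have c1 := @cvgM R C (nbhs z) Fz _ _ _ _ (cd z) (cu z).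
  have c2 := @cvgM R C (nbhs z) Fz _ _ _ _ c1 (@cst_continuous C R (8^-1) z).
  have c3 := @cvgD R R^o C (nbhs z) Fz _ _ _ _ (@cst_continuous C R 1 z) c2.
  have c4 := @cvgV R C (nbhs z) Fz _ _ (lt0r_neq0 (den0 z)) c3.
  exact: (@cvgM R C (nbhs z) Fz _ _ _ _ (cu z) c4).
have r0 : 0 <= 8 / U by rewrite divr_ge0 // ltW.
have [zs zsr zsmax] := disc_EVT z0 r0 cF.
set m := modulus (u zs); set s := modulus (zs - z0) in zsr.
have s0 : 0 <= s by exact: modulus_ge0.
have m0 : 0 <= m by exact: modulus_ge0.
have : U <= m / (1 + s * m / 8).
  have := zsmax z0; rewrite /F subrr modulus0 mul0r mul0r addr0 divr1; exact.
have den1 : 0 < 1 + s * m / 8 by exact: den0.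
rewrite ler_pdivlMr // => Um.
have Um' : U <= m by apply: le_trans Um; rewrite ler_peMr ?(ltW U0) // lerDl
  divr_ge0 // mulr_ge0.
have mgt0 : 0 < m by exact: lt_le_trans Um'.
have s_lt : s < 8 / U.
  rewrite ltr_pdivlMr // -(ltr_pM2r mgt0).
  have : U * (s * m / 8) < m by apply: lt_le_trans Um;
    rewrite mulrDr mulr1 ltrDr.
  lra.
pose lam := - (p zs + u zs ^+ 2).
have lam_ge : m ^+ 2 / 2 <= modulus lam.
  have := modulusB (- lam) (p zs).
  rewrite /lam opprK [p zs + _]addrC addrK modulusX -/m modulusN.
  have := pU zs zsr.
  have : U ^+ 2 <= m ^+ 2 by rewrite ler_pXn2r // nnegrE ltW.
  rewrite [u zs ^+ 2 + _]addrC; lra.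
have lam0 : 0 < modulus lam by apply: lt_le_trans lam_ge;
  rewrite divr_gt0 // exprn_gt0.
have e0 : 0 < m ^+ 2 / 4 by rewrite divr_gt0 // exprn_gt0.
have [ra ra0 Hra] := is_derive_approx (ud zs) e0.
(* small enough for the linear approximation of [u] to hold at [zs + k] and for
   this point to remain in the disc *)
pose t := Num.min 1 (Num.min (m * ra / 4) (m * (8 / U - s) / 2)).
have t0 : 0 < t.
  rewrite !lt_min ltr01 /= !divr_gt0 ?mulr_gt0 //.
  by rewrite subr_gt0.
have t1 : t <= 1 by rewrite ge_min lexx.
have t2 : t <= m * ra / 4 by rewrite !ge_min lexx orbT.
have t3 : t <= m * (8 / U - s) / 2 by rewrite !ge_min lexx !orbT.
clearbody t.
pose k : C := t%:C%C * u zs / lam.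
have kle : modulus k <= 2 * t / m.
  rewrite !modulusM modulusV modulus_real (ger0_norm (ltW t0)) -/m.
  rewrite ler_pdivrMr // mulrAC ler_pdivlMr // -mulrA -expr2.
  have := ler_wpM2l (ltW t0) lam_ge; lra.
have kra : modulus k < ra.
  apply: le_lt_trans kle _; rewrite ltr_pdivrMr //.
  have : 0 < m * ra by rewrite mulr_gt0.
  lra.
have lamk : lam * k = t%:C%C * u zs.
  by rewrite mulrC divfK // -modulus_gt0.
have := Hra k kra; rewrite -/lam lamk => app.
set m' := modulus (u (zs + k)).
have m'_ge : m * (1 + t / 2) <= m'.
  have mk : m ^+ 2 / 4 * modulus k <= m * t / 2.
    apply: le_trans (ler_wpM2l (ltW e0) kle) _.
    by rewrite le_eqVlt; apply/orP; left; apply/eqP; field; rewrite gt_eqF.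
  have E : modulus (u zs + t%:C%C * u zs) = m * (1 + t).
    have -> : u zs + t%:C%C * u zs = (1 + t)%:C%C * u zs.
      by rewrite rmorphD rmorph1 mulrDl mul1r.
    by rewrite modulusM modulus_real ger0_norm 1?mulrC // addr_ge0 // ltW.
  have := modulusD (u zs + t%:C%C * u zs - u (zs + k)) (u (zs + k)).
  rewrite subrK E modulus_distC opprD addrA -/m' => H.
  have := le_trans H (lerD (le_trans app mk) (lexx _)); lra.
have s'_le : modulus (zs + k - z0) <= s + 2 * t / m.
  rewrite addrAC; apply: le_trans (modulusD _ _) _; by rewrite lerD2l.
have Fk : F (zs + k) <= F zs.
  apply: zsmax; apply: le_trans s'_le _; rewrite -lerBrDl ler_pdivrMr //; lra.
move: Fk; rewrite /F ler_pdivrMr // mulrAC ler_pdivlMr // -/s -/m -/m'.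
set s' := modulus (zs + k - z0) in s'_le *.
have m'0 : 0 <= m' by exact: modulus_ge0.
move=> Fk.
have s'm : s' * m <= s * m + 2 * t by rewrite -ler_pdivlMr // mulrDl mulfK
  ?gt_eqF.
have : m' * (1 + s * m / 8) <= m + m' * (s' * m) / 8 by lra.
have := ler_wpM2l m'0 s'm => h1 h2.
have h3 : m' * (1 - t / 4) <= m by lra.
have h4 : m * (1 + t / 2) * (1 - t / 4) <= m' * (1 - t / 4).
  by rewrite ler_wpM2r //; lra.
(* the relative gain of [t / 2] in [|u|] outweighs the loss of at most [t / 4]
   caused by the weight [1 / 8] on the distance *)
have h5 : 0 < m * (t * (2 - t)) by rewrite !mulr_gt0 //; lra.
nra.
Qed.

Lemma poly_growth (p : {poly C}) (n : nat) : (size p <= n.+1)%N ->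
  exists2 S : R, 0 <= S & forall z, modulus p.[z] <= S * (1 + modulus z) ^+ n.
Proof.
move=> pn; exists (\sum_(i < size p) modulus p`_i).
  by apply: sumr_ge0 => i _; exact: modulus_ge0.
move=> z; rewrite horner_coef; apply: le_trans (modulus_sum _) _.
rewrite mulr_suml; apply: ler_sum => i _; rewrite modulusM modulusX.
rewrite ler_wpM2l ?modulus_ge0 //.
apply: (@le_trans _ _ ((1 + modulus z) ^+ i)).
  by rewrite lerXn2r ?nnegrE ?modulus_ge0 ?addr_ge0 ?modulus_ge0 // lerDr.
by rewrite ler_weXn2l ?lerDl ?modulus_ge0 // -ltnS (leq_trans (ltn_ord i)).
Qed.

(** Once [|u z|] exceeds 8, the disc in which [riccati_blowup] requires a bound
    on [p] has radius at most 1. *)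
Lemma riccati_growth (p : {poly C}) (u : C -> C) (n : nat) :
  (size p <= n.+1)%N ->
  (forall z : C, is_derive z 1 u (- (p.[z] + u z ^+ 2))) ->
  exists2 K : R, 0 < K & forall z, modulus (u z) ^+ 2 <= K * (2 + modulus z) ^+
    n.
Proof.
move=> pn ud; have [S S0 pS] := poly_growth pn.
exists (64 + 2 * S); first by rewrite ltr_wpDr // mulr_ge0.
move=> z; rewrite leNgt; apply/negP => big.
have Z1 : 1 <= (2 + modulus z) ^+ n.
  by rewrite exprn_ege1 // ler_wpDr ?modulus_ge0 // ler1n.
have SZ : 0 <= S * (2 + modulus z) ^+ n by rewrite mulr_ge0 // (le_trans ler01).
have U64 : 8 ^+ 2 < modulus (u z) ^+ 2.
  by apply: le_lt_trans big; rewrite mulrDl; lra.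
have U8 : 8 < modulus (u z).
  by move: U64; rewrite ltr_pXn2r // nnegrE ?modulus_ge0.
have U0 : 0 < modulus (u z) by apply: lt_trans U8.
apply: (riccati_blowup ud U0) => y yz.
have y1 : modulus y <= 1 + modulus z.
  rewrite -[y](subrK z); apply: le_trans (modulusD _ _) _; rewrite lerD2r.
  by apply: le_trans yz _; rewrite ler_pdivrMr // mul1r ltW.
apply: le_trans (pS y) _.
apply: (@le_trans _ _ (S * (2 + modulus z) ^+ n)).
  rewrite ler_wpM2l // lerXn2r ?nnegrE ?addr_ge0 ?modulus_ge0 //; lra.
move: big; rewrite mulrDl; lra.
Qed.

End riccati.

(** * The Riccati equation of odd degree has no entire solution *)

Section riccati_odd.
Variable R : realType.
Local Notation C := (cplx R).

(** By the growth bound and the Cauchy estimate on a disc of radius [|z| / 2],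
    [u'] is smaller than [p] by a power of [z], so [u ^ 2 = - p - u'] has the
    same leading behaviour as [- p]. *)
Lemma riccati_asymptotics (p : {poly C}) (u : C -> C) (n : nat) :
  size p = n.+2 ->
  (forall z : C, is_derive z 1 u (- (p.[z] + u z ^+ 2))) ->
  exists2 rho : R, 0 < rho & forall z, rho <= modulus z ->
    modulus (u z ^+ 2 + lead_coef p * z ^+ n.+1)
      <= modulus (lead_coef p) * modulus z ^+ n.+1 / 2.
Proof.
move=> pn ud; set a := lead_coef p.
have pn' : (size p <= n.+2)%N by rewrite pn.
have a0 : 0 < modulus a by rewrite modulus_gt0 lead_coef_eq0 -size_poly_gt0 pn.
pose q : {poly C} := \poly_(i < n.+1) p`_i.
have pE z : p.[z] = q.[z] + a * z ^+ n.+1.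
  by rewrite horner_coef pn big_ord_recr /= horner_poly /a lead_coefE pn.
have [S S0 qS] := poly_growth (size_poly n.+1 (fun i => p`_i)).
have [K K0 uK] := riccati_growth pn' ud.
pose u1 z := - (p.[z] + u z * u z).
pose u2 z := - (p^`().[z] + (u1 z * u z + u z * u1 z)).
have u1d (z : C) : is_derive z 1 u1 (u2 z).
  exact (is_derive_opp (is_derive_add (is_derive_horner p z)
    (is_derive_mul (ud z) (ud z)))).
pose u3 z := - (p^`()^`().[z] + ((u2 z * u z + u1 z * u1 z) + (u1 z * u1 z + u
  z * u2 z))).
have u2d (z : C) : is_derive z 1 u2 (u3 z).
  exact (is_derive_opp (is_derive_add (is_derive_horner p^`() z)
    (is_derive_add (is_derive_mul (u1d z) (ud z)) (is_derive_mul (ud z)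
      (u1d z))))).
have u3c : continuous u3.
  move=> z; exact: (is_derive_continuous (is_derive_opp (is_derive_add
    (is_derive_horner p^`()^`() z)
    (is_derive_add
      (is_derive_add (is_derive_mul (u2d z) (ud z)) (is_derive_mul (u1d z)
        (u1d z)))
      (is_derive_add (is_derive_mul (u1d z) (u1d z)) (is_derive_mul (ud z)
        (u2d z))))))).
(* [X1] and [X2] bound the region where [u'] and the lower-order part [q] of [p]
   may exceed a quarter of the leading term. *)
pose X1 := 256 * K * 2 ^+ n.+1 / modulus a ^+ 2.
pose X2 := 4 * S * 2 ^+ n / modulus a.
have X10 : 0 <= X1.
  by rewrite divr_ge0 ?exprn_ge0 ?(ltW a0) // !mulr_ge0 ?(ltW K0) ?exprn_ge0.
have X20 : 0 <= X2.
  by rewrite divr_ge0 ?(ltW a0) // !mulr_ge0 ?exprn_ge0.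
exists (4 + X1 + X2); first lra.
move=> z; set r := modulus z => rz.
have r4 : 4 <= r by lra.
have r1 : 1 <= r by lra.
have r0 : 0 < r by lra.
have rn0 (m : nat) : 0 <= r ^+ m by rewrite exprn_ge0 // ltW.
have rX : r <= r ^+ n.+1 by rewrite exprS ler_peMr ?(ltW r0) // exprn_ege1.
pose M := Num.sqrt (K * (2 * r) ^+ n.+1).
have M2 : M ^+ 2 = K * (2 * r) ^+ n.+1.
  by rewrite sqr_sqrtr // mulr_ge0 ?exprn_ge0 ?mulr_ge0 ?(ltW r0) ?(ltW K0).
have M0 : 0 <= M by exact: sqrtr_ge0.
have u1_small : modulus (u1 z) <= modulus a * r ^+ n.+1 / 4.
  have r2 : 0 < r / 2 by rewrite divr_gt0.
  have cau : modulus (u1 z) * (r / 2) <= 2 * M.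
    apply: (@cauchy_estimate _ u u1 u2 u3 z M (r / 2) r2 ud u1d u2d u3c) =>
      y yz.
    rewrite -(@ler_pXn2r _ 2) ?nnegrE ?modulus_ge0 // M2.
    apply: le_trans (uK y) _; rewrite ler_wpM2l ?(ltW K0) //.
    rewrite lerXn2r ?nnegrE ?addr_ge0 ?modulus_ge0 ?mulr_ge0 ?(ltW r0) //.
    have := modulusD (y - z) z; rewrite subrK -/r; lra.
  rewrite -(@ler_pXn2r _ 2) ?nnegrE ?modulus_ge0 ?divr_ge0 ?mulr_ge0 ?(ltW a0)
    //.
  have sq : (modulus (u1 z) * (r / 2)) ^+ 2 <= 4 * (K * (2 * r) ^+ n.+1).
    have M4 : 4 * M ^+ 2 = (2 * M) ^+ 2 by ring.
    by rewrite -M2 M4 lerXn2r ?nnegrE ?mulr_ge0 ?modulus_ge0 ?(ltW r2).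
  have aX : 256 * K * 2 ^+ n.+1 <= modulus a ^+ 2 * r ^+ n.+1.
    apply: (@le_trans _ _ (modulus a ^+ 2 * r)); last by rewrite ler_wpM2l
      ?sqr_ge0.
    by rewrite [leRHS]mulrC -ler_pdivrMr ?exprn_gt0 // -/X1; lra.
  have aXX := ler_wpM2r (rn0 n.+1) aX.
  rewrite exprMn in sq; rewrite expr_div_n exprMn.
  have u1r : modulus (u1 z) ^+ 2 <= modulus (u1 z) ^+ 2 * r ^+ 2.
    by rewrite ler_peMr ?sqr_ge0 // exprn_ege1.
  move: sq; rewrite expr_div_n exprMn => sq.
  rewrite [(r ^+ n.+1) ^+ 2]expr2; lra.
have q_small : modulus q.[z] <= modulus a * r ^+ n.+1 / 4.
  apply: le_trans (qS z) _.
  apply: (@le_trans _ _ (S * (2 * r) ^+ n)).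
    rewrite ler_wpM2l // lerXn2r ?nnegrE ?addr_ge0 ?modulus_ge0 ?mulr_ge0
      ?(ltW r0) //.
    rewrite -/r; lra.
  have X2r : 4 * S * 2 ^+ n <= r * modulus a by rewrite -ler_pdivrMr // -/X2;
    lra.
  have := ler_wpM2r (rn0 n) X2r; rewrite exprMn exprS; lra.
have -> : u z ^+ 2 + a * z ^+ n.+1 = - (u1 z + q.[z]).
  by rewrite /u1 pE; ring.
rewrite modulusN; apply: le_trans (modulusD _ _) _; lra.
Qed.

(** An odd function on the complement of a disc cannot have a square that stays
    close to 1: its real part would not vanish on a path joining a point to its
    opposite. Applied to [u (ze ^ 2) / (b ze ^ d)] this expresses that [z ^ d]
    has no continuous square root near infinity. *)
Lemma riccati_odd (p : {poly C}) (u : C -> C) : odd (size p).-1 ->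
  ~ (forall z : C, is_derive z 1 u (- (p.[z] + u z ^+ 2))).
Proof.
case pn : (size p) => [//|[//|n]] /= n_odd ud.
have [rho rho0 urho] := riccati_asymptotics pn ud.
set a := lead_coef p in urho.
have a0 : a != 0 by rewrite lead_coef_eq0 -size_poly_gt0 pn.
pose b : C := sqrtc (- a).
have b2 : b ^+ 2 = - a by exact: sqr_sqrtc.
have b0 : b != 0.
  by apply/eqP => b0; move/eqP: b2; rewrite b0 expr0n eq_sym oppr_eq0
    (negbTE a0).
pose v (ze : C) := u (ze * ze) / (b * ze ^+ n.+1).
have v_close (ze : C) : rho <= modulus ze ^+ 2 -> modulus (v ze ^+ 2 - 1) <=
  2^-1.
  move=> zer; have ze0 : ze != 0.
    by rewrite -modulus_gt0 lt_def modulus_ge0 andbT; apply: contraTneq zer =>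
      ->; rewrite expr0n -ltNge.
  have -> : v ze ^+ 2 - 1 = - ((u (ze * ze) ^+ 2 + a * (ze * ze) ^+ n.+1) /
    (a * (ze * ze) ^+ n.+1)).
    have zn0 : ze ^+ n.+1 != 0 by rewrite expf_neq0.
    rewrite /v expr_div_n [(b * _) ^+ 2]exprMn b2 [(ze * ze) ^+ _]exprMn; field.
    by rewrite a0 zn0.
  rewrite modulusN modulusM modulusV ler_pdivrMr; last by rewrite modulus_gt0
    mulf_neq0 // expf_neq0 // mulf_neq0.
  rewrite modulusM modulusX [leRHS]mulrC; apply: urho;
    by rewrite modulusM -expr2.
have v_odd (ze : C) : v (- ze) = - v ze.
  by rewrite /v mulrNN exprNn -signr_odd /= n_odd expr1 mulN1r mulrN invrN
    mulrN.
have Re_v (ze : C) : rho <= modulus ze ^+ 2 -> complex.Re (v ze) != 0.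
  move=> /v_close vc; apply/eqP => re0; move: vc; apply/negP; rewrite -ltNge.
  apply: lt_le_trans (Re_le_modulus _); case: (v ze) re0 => x y /= ->.
  rewrite mul0r sub0r -normrN opprB opprK ger0_norm ?addr_ge0 //;
    last by rewrite -expr2 sqr_ge0.
  have := sqr_ge0 y; rewrite expr2; lra.
have [T0 Trho] : 0 < rho + 2 /\ rho <= (rho + 2) ^+ 2 * (3 / 4) by split; nra.
set T := rho + 2 in T0 Trho.
(* a parabolic arc from [- T] to [T] which avoids the disc around the origin: the
   square of its modulus is [T ^ 2 ((t ^ 2 - 1 / 2) ^ 2 + 3 / 4)] *)
pose q (y : C) : C := T%:C%C * (y + 'i%C * (1 - y * y)).
pose path (t : R) : C := q t%:C%C.
have path_large (t : R) : rho <= modulus (path t) ^+ 2.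
  apply: le_trans Trho _; rewrite modulusM exprMn modulus_real ger0_norm
    ?(ltW T0) //.
  rewrite ler_wpM2l ?sqr_ge0 // sqr_modulus /=.
  have -> : (t + (0 * (1 - (t * t - 0 * 0)) - 1 * (0 - (t * 0 + 0 * t)))) ^+ 2
    + (0 + (0 * (0 - (t * 0 + 0 * t)) + 1 * (1 - (t * t - 0 * 0)))) ^+ 2
    = (t ^+ 2 - 2^-1) ^+ 2 + 3 / 4 by field.
  by rewrite lerDr sqr_ge0.
have qd (y : C) : exists d, is_derive y 1 q d.
  have idy := is_derive_id (y : C^o) 1.
  eexists; exact (is_derive_mull T%:C%C (is_derive_add idy (is_derive_mull 'i%C
    (is_derive_sub (is_derive_cst (1 : C^o) y 1) (is_derive_mul idy idy))))).
have vd (y : C) : y != 0 -> exists d, is_derive y 1 v d.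
  move=> y0; have idy := is_derive_id (y : C^o) 1.
  have dn0 : b * y ^+ n.+1 != 0 by rewrite mulf_neq0 ?expf_neq0.
  have den : is_derive y 1 (fun y : C => b * y ^+ n.+1) (b * 'X^(n.+1)^`().[y]).
    have -> : (fun y : C => b * y ^+ n.+1) = (fun y => b * 'X^(n.+1).[y]).
      by apply/funext => x; rewrite hornerXn.
    exact: is_derive_mull (is_derive_horner _ _).
  eexists; exact (is_derive_mul
    (@is_derive_compose C u (fun y => y * y) y _ _ (ud (y * y)) (is_derive_mul
      idy idy))
    (@is_derive_inv C (fun y => b * y ^+ n.+1) y _ dn0 den)).
have phi_cont : continuous (fun t : R => complex.Re (v (path t))).
  move=> t; have [d qt] := qd t%:C%C.
  have [|e vt] := vd (path t).
    by rewrite -modulus_gt0 lt_def modulus_ge0 andbT;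
      apply: contraTneq (path_large t)
      => ->; rewrite expr0n -ltNge.
  have vq := @is_derive_compose C v q _ _ _ vt qt.
  have -> : (fun t : R => complex.Re (v (path t))) =
      (fun t : R => complex.Re (1 * v (q (0 + t%:C%C * 1)))).
    by apply/funext => s; rewrite mul1r add0r mulr1.
  apply: is_derive_continuous.
  apply: (@is_derive_line _ (fun y => v (q y)) 0 1 1 (e * d) t).
  by rewrite add0r mulr1.
have path1 : path 1 = T%:C%C by rewrite /path /q rmorph1 mulr1 subrr mulr0
  addr0 mulr1.
have pathN1 : path (-1) = - path 1.
  by rewrite path1 /path /q rmorphN rmorph1 mulrNN mulr1 subrr mulr0 addr0
    mulrN1.
have [|||t _] := @IVT R (fun t : R => complex.Re (v (path t))) (-1) 1 0.
- by lra.
- exact: continuous_subspaceT.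
- rewrite pathN1 v_odd ReN ge_min le_max.
  have [h|h] := leP 0 (complex.Re (v (path 1))); first by rewrite oppr_le0 h /=
    orbT.
  by rewrite (ltW h) orbT /= oppr_ge0 (ltW h).
by move=> phi0; move: (Re_v _ (path_large t)); rewrite phi0 eqxx.
Qed.

End riccati_odd.

(** * Uniqueness of solutions with given initial values *)

Section gronwall.
Variable R : realType.
Local Notation C := (cplx R).

Lemma gronwall (E dE : R -> R) (K : R) :
  (forall t : R, is_derive t 1 E (dE t)) ->
  (forall t, 0 < t < 1 -> dE t <= K * E t) -> E 0 = 0 -> E 1 <= 0.
Proof.
move=> Ed dEK E0.
pose G (t : R) := expR (- K * t) * E t.
have Gd (t : R) : is_derive t 1 G (expR (- K * t) * (- K) * E t + expR
  (- K * t) * dE t).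
  apply: is_derive_mul.
  have kd : is_derive t 1 (fun s : R => - K * s) (- K).
    apply: (is_derive_eq (is_derive_mull (- K) (is_derive_id (t : R^o) 1))).
    by rewrite mulr1.
  exact: (@is_derive_compose R expR (fun s => - K * s) t _ _ (is_derive_expR _)
    kd).
have [c c01] := real_mean_value ltr01 Gd.
rewrite /G E0 !mulr0 !subr0 !mulr1 => GE.
have : expR (- K) * E 1 <= 0.
  rewrite GE -mulrA -mulrDr mulr_ge0_le0 ?expR_ge0 // mulNr addrC subr_le0.
  exact: dEK.
by rewrite pmulr_rle0 // expR_gt0.
Qed.

Lemma real_uniqueness (f f1 p : R -> R) (x0 B : R) (x : R) :
  (forall y : R, is_derive y 1 f (f1 y)) ->
  (forall y : R, is_derive y 1 f1 (- (p y * f y))) ->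
  (forall y, `|y - x0| <= `|x - x0| -> `|p y| <= B) ->
  f x0 = 0 -> f1 x0 = 0 -> f x = 0 /\ f1 x = 0.
Proof.
move=> fd f1d pB fx0 f1x0.
pose h := x - x0; pose y (t : R) := x0 + t * h.
pose g t := f (y t) ^+ 2 + f1 (y t) ^+ 2.
pose dg t := 2 * h * (f (y t) * f1 (y t) * (1 - p (y t))).
have gd (t : R) : is_derive t 1 g (dg t).
  have d0 := is_derive_affine (fd (y t)); have d1 := is_derive_affine
    (f1d (y t)).
  apply: (is_derive_eq (is_derive_add (is_derive_mul d0 d0) (is_derive_mul d1
    d1))).
  by rewrite /dg /y; ring.
have := @gronwall g dg (`|h| * (1 + B)) gd.
rewrite /g /y mul0r addr0 mul1r fx0 f1x0 expr0n addr0 subrKC => H.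
have /H {}H : forall t, 0 < t < 1 -> dg t <= `|h| * (1 + B) * (f (x0 + t * h)
  ^+ 2 + f1 (x0 + t * h) ^+ 2).
  move=> t /andP[t0 t1]; rewrite /dg /y.
  have pt : `|p (x0 + t * h)| <= B.
    apply: pB; rewrite addrAC subrr add0r normrM (ger0_norm (ltW t0)).
    by rewrite ler_piMl ?(ltW t1).
  apply: le_trans (ler_norm _) _; rewrite !normrM ger0_norm // [2 * _]mulrC
    -!mulrA ler_wpM2l //.
  set a := f _; set b := f1 _ in pt *.
  have ab : 2 * (`|a| * `|b|) <= a ^+ 2 + b ^+ 2.
    rewrite -(real_normK (num_real a)) -(real_normK (num_real b)).
    have := sqr_ge0 (`|a| - `|b|); lra.
  have p1 : `|1 - p (x0 + t * h)| <= 1 + B.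
    by apply: le_trans (ler_normB _ _) _; rewrite normr1 lerD2l.
  rewrite [leLHS](_ : _ = `|1 - p (x0 + t * h)| * (2 * (`|a| * `|b|)));
    last by ring.
  by apply: ler_pM => //; rewrite !mulr_ge0.
have h0 := H erefl.
have : f x ^+ 2 + f1 x ^+ 2 == 0 by rewrite eq_le h0 addr_ge0 ?sqr_ge0.
by rewrite paddr_eq0 ?sqr_ge0 // !sqrf_eq0 => /andP[/eqP -> /eqP ->].
Qed.

Lemma is_derive_sqr_modulus (f : C -> C) (z0 h d : C) (t : R) :
  is_derive (z0 + t%:C%C * h) 1 f d ->
  is_derive t 1 (fun s : R => modulus (f (z0 + s%:C%C * h)) ^+ 2)
    (2 * complex.Re (conjc (f (z0 + t%:C%C * h)) * (d * h))).
Proof.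
move=> fd.
have re := is_derive_line 1 fd; have im := is_derive_line (- 'i%C) fd.
have -> : (fun s : R => modulus (f (z0 + s%:C%C * h)) ^+ 2) =
  (fun s : R => complex.Re (1 * f (z0 + s%:C%C * h)) * complex.Re
    (1 * f (z0 + s%:C%C * h))
    + complex.Re (- 'i%C * f (z0 + s%:C%C * h)) * complex.Re
      (- 'i%C * f (z0 + s%:C%C * h))).
  by apply/funext => s; rewrite sqr_modulus; case: (f _) => x y /=; ring.
apply: (is_derive_eq (is_derive_add (is_derive_mul re re) (is_derive_mul im
  im))).
by case: (f _) (d * h) => x y [x' y'] /=; ring.
Qed.

(** Along the segment from [z0] to [z] the energy [|w| ^ 2 + |w'| ^ 2] grows at
    most exponentially from its initial value 0. *)
Lemma complex_uniqueness (p : {poly C}) (w w1 : C -> C) (z0 : C) :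
  (forall z : C, is_derive z 1 w (w1 z)) ->
  (forall z : C, is_derive z 1 w1 (- (p.[z] * w z))) ->
  w z0 = 0 -> w1 z0 = 0 -> forall z, w z = 0.
Proof.
move=> wd w1d w0 w10 z; pose h := z - z0.
have [B B0 pB] : exists2 B, 0 <= B & forall y, modulus (y - z0) <= modulus h ->
  modulus p.[y] <= B.
  apply: bounded_on_disc => y; exact: (is_derive_continuous (is_derive_horner p
    y)).
pose E (t : R) := modulus (w (z0 + t%:C%C * h)) ^+ 2 + modulus
  (w1 (z0 + t%:C%C * h)) ^+ 2.
have Ed (t : R) := is_derive_add (is_derive_sqr_modulus (wd (z0 + t%:C%C * h)))
  (is_derive_sqr_modulus (w1d (z0 + t%:C%C * h))).
have := @gronwall E _ (modulus h * (1 + B)) Ed.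
have -> : E 0 = 0 by rewrite /E rmorph0 mul0r addr0 w0 w10 modulus0 expr0n
  addr0.
have -> : E 1 = modulus (w z) ^+ 2 + modulus (w1 z) ^+ 2.
  by rewrite /E rmorph1 mul1r subrKC.
move=> H; have /H {}H : forall t, 0 < t < 1 -> 2 * complex.Re
  (conjc (w (z0 + t%:C%C * h)) * (w1 (z0 + t%:C%C * h) * h)) +
   2 * complex.Re (conjc (w1 (z0 + t%:C%C * h)) *
     (- (p.[z0 + t%:C%C * h] * w (z0 + t%:C%C * h)) * h)) <= modulus h *
     (1 + B) * E t.
  move=> t /andP[t0 t1].
  have pt : modulus p.[z0 + t%:C%C * h] <= B.
    apply: pB; rewrite addrAC subrr add0r modulusM modulus_real
      (ger0_norm (ltW t0)).
    by rewrite ler_piMl ?modulus_ge0 ?(ltW t1).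
  have conj_mod (a : C) : modulus (conjc a) = modulus a.
    by case: a => x y; rewrite /modulus /= sqrrN.
  rewrite /E; set a := w _; set b := w1 _; set q := p.[_] in pt *.
  have h1 : complex.Re (conjc a * (b * h)) <= modulus a * modulus b * modulus h.
    by apply: le_trans (ler_norm _) (le_trans (Re_le_modulus _) _);
      rewrite !modulusM conj_mod mulrA.
  have h2 : complex.Re (conjc b * (- (q * a) * h)) <= B * (modulus a * modulus
    b * modulus h).
    apply: le_trans (ler_norm _) (le_trans (Re_le_modulus _) _).
    rewrite !modulusM conj_mod modulusN modulusM.
    rewrite [leLHS](_ : _ = modulus q * (modulus a * modulus b * modulus h));
      last by ring.
    by rewrite ler_wpM2r // !mulr_ge0 ?modulus_ge0.
  have h3 : (1 + B) * modulus h * (2 * (modulus a * modulus b)) <=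
    (1 + B) * modulus h * (modulus a ^+ 2 + modulus b ^+ 2).
    rewrite ler_wpM2l ?mulr_ge0 ?modulus_ge0 ?addr_ge0 //.
    have := sqr_ge0 (modulus a - modulus b); lra.
  lra.
have h0 := H erefl.
have : modulus (w z) ^+ 2 + modulus (w1 z) ^+ 2 == 0 by rewrite eq_le h0
  addr_ge0 ?sqr_ge0.
by rewrite paddr_eq0 ?sqr_ge0 // sqrf_eq0 modulus_eq0 => /andP[/eqP -> _].
Qed.

Lemma zero_free_even_degree (p : {poly C}) (w w1 : C -> C) :
  (forall z : C, is_derive z 1 w (w1 z)) ->
  (forall z : C, is_derive z 1 w1 (- (p.[z] * w z))) ->
  (forall z, w z != 0) -> ~~ odd (size p).-1.
Proof.
move=> wd w1d w0; apply/negP => deg_odd;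
  apply: (@riccati_odd R p (fun z => w1 z * (w z)^-1) deg_odd) => z.
apply: (is_derive_eq (is_derive_mul (w1d z) (is_derive_inv (w0 z) (wd z)))).
have := w0 z; move: (w z) (w1 z) (p.[z]) => a b c wz; field.
exact: wz.
Qed.
End gronwall.

(** * Oscillation on the real axis *)

Section sturm.
Variable R : realType.
Implicit Types (f p : R -> R) (A m x y t : R).

(** The derivative is carried as a function of its own, so that [solves] also
    records that both [f] and its derivative are differentiable. *)
Definition solves (p f f1 : R -> R) : Prop :=
  (forall x, is_derive x 1 f (f1 x)) /\
  (forall x, is_derive x 1 f1 (- (p x * f x))).

Definition zeros f : set R := [set x | f x = 0].

(** A positive solution is concave on the half-line, hence nondecreasing; then
    [f''] stays below a negative constant, which drives [f'] below 0. *)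
Lemma positive_not_oscillating p f f1 A m : solves p f f1 -> 0 < m ->
  (forall x, A <= x -> m <= p x) -> ~ (forall x, A <= x -> 0 < f x).
Proof.
move=> [fd f1d] m0 pm fpos.
have f1_decr x y : A <= x -> x < y -> f1 y <= f1 x.
  move=> Ax xy; have [c /andP[xc _] E] := real_mean_value xy f1d.
  have Ac : A <= c by apply: le_trans Ax (ltW xc).
  rewrite -subr_le0 E mulNr oppr_le0 mulr_ge0 ?subr_ge0 ?(ltW xy) // mulr_ge0
    ?(ltW (fpos _ Ac)) //.
  exact: le_trans (ltW m0) (pm _ Ac).
have f1_ge0 x : A <= x -> 0 <= f1 x.
  move=> Ax; rewrite leNgt; apply/negP => neg.
  have fx0 := fpos x Ax.
  pose y := x + f x / (- f1 x).
  have yx : x < y by rewrite ltrDl divr_gt0 // oppr_gt0.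
  have [c /andP[xc _] E] := real_mean_value yx fd.
  have Ay : A <= y by apply: le_trans Ax (ltW yx).
  have := fpos y Ay; rewrite ltNge => /negP; apply.
  rewrite -(subrK (f x) (f y)) E.
  have yxE : y - x = f x / - f1 x by rewrite /y addrAC subrr add0r.
  have : f1 c * (y - x) <= f1 x * (y - x).
    by rewrite ler_wpM2r ?subr_ge0 ?(ltW yx) // f1_decr.
  have -> : f1 x * (y - x) = - f x.
    rewrite yxE; field; by rewrite lt_eqF.
  lra.
have f_ge x : A <= x -> f A <= f x.
  rewrite le_eqVlt => /predU1P[->//|Ax].
  have [c /andP[Ac _] E] := real_mean_value Ax fd.
  by rewrite -subr_ge0 E mulr_ge0 ?subr_ge0 ?(ltW Ax) // f1_ge0 // ltW.
have fA0 := fpos A (lexx A).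
have mf : 0 < m * f A by rewrite mulr_gt0.
pose y := A + (f1 A / (m * f A) + 1).
have Ay : A < y by rewrite ltrDl ltr_wpDl // divr_ge0 ?f1_ge0 // ltW.
have [c /andP[Ac _] E] := real_mean_value Ay f1d.
have := f1_ge0 y (ltW Ay); rewrite leNgt => /negP; apply.
rewrite -(subrK (f1 A) (f1 y)) E.
have pf : m * f A <= p c * f c.
  by apply: ler_pM; rewrite ?(ltW m0) ?(ltW fA0) ?pm ?f_ge ?(ltW Ac).
have yA0 : 0 <= y - A by rewrite subr_ge0 ltW.
have := ler_wpM2r yA0 pf.
have -> : m * f A * (y - A) = f1 A + m * f A.
  by rewrite /y; field; rewrite !gt_eqF.
lra.
Qed.

Lemma solvesN p f f1 : solves p f f1 -> solves p (fun x => - f x) (fun x =>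
  - f1 x).
Proof.
move=> [fd f1d]; split=> x; first exact: is_derive_opp.
apply: (is_derive_eq (is_derive_opp (f1d x))); by rewrite mulrN.
Qed.

Lemma solves_reflect p f f1 : solves p f f1 ->
  solves (fun x => p (- x)) (fun x => f (- x)) (fun x => - f1 (- x)).
Proof.
move=> [fd f1d]; split=> x.
  have nd : is_derive x 1 (fun y : R => - y) (-1) by exact: is_deriveNid.
  apply: (is_derive_eq (@is_derive_compose R f (fun y => - y) x _ _ (fd (- x))
    nd)).
  by rewrite mulrN1.
have nd : is_derive x 1 (fun y : R => - y) (-1) by exact: is_deriveNid.
apply: (is_derive_eq (is_derive_opp (@is_derive_compose R f1 (fun y => - y) x _
  _ (f1d (- x)) nd))).
by rewrite mulrN1 opprK.
Qed.

Lemma oscillation p f f1 A m : solves p f f1 -> 0 < m ->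
  (forall x, A <= x -> m <= p x) -> ~ has_ubound (zeros f).
Proof.
move=> sol m0 pm [M Mub].
pose B := Num.max A (M + 1).
have AB : A <= B by rewrite le_max lexx.
have MB : M < B by apply: lt_le_trans (_ : M + 1 <= B);
  rewrite ?ltrDl // le_max lexx orbT.
have fn0 x : B <= x -> f x != 0.
  move=> Bx; apply/eqP => /Mub; rewrite leNgt (lt_le_trans MB) //.
have fc (x y : R) : {within `[x, y], continuous f}.
  by apply: continuous_subspaceT => t; exact: is_derive_continuous (sol.1 t).
(* no change of sign beyond [B], by the intermediate value theorem *)
have same_sign x : B <= x -> 0 < f B * f x.
  move=> Bx; rewrite ltNge; apply/negP => neg.
  have [|c] := @IVT R f B x 0 Bx (fc B x).
    rewrite ge_min le_max; have := fn0 B (lexx B); rewrite neq_lt => /orP[h|h].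
      by rewrite (ltW h) /=; move: neg; rewrite nmulr_rle0 // => ->;
        rewrite orbT.
    by rewrite (ltW h) /= andbT; move: neg; rewrite pmulr_rle0 // => ->;
      rewrite orbT.
  rewrite in_itv /= => /andP[Bc _] /eqP; exact/negP/fn0.
have pmB x : B <= x -> m <= p x by move=> Bx; apply: pm; apply: le_trans Bx.
have := fn0 B (lexx B); rewrite neq_lt => /orP[fB|fB].
  apply: (positive_not_oscillating (solvesN sol) m0 pmB) => x Bx.
  by have := same_sign x Bx; rewrite nmulr_rgt0 // oppr_gt0.
apply: (positive_not_oscillating sol m0 pmB) => x Bx.
by have := same_sign x Bx; rewrite pmulr_rgt0.
Qed.

(** Where [p <= 0] the product [f f'] is nondecreasing. It vanishes at a zero [x]
    of [f] and at the critical point [xi] between [x] and a further zero, so it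
    vanishes in between; then [f ^ 2] is constant there and [xi] is a double
    zero of [f]. *)
Lemma nonoscillation p f f1 A : solves p f f1 ->
  (forall x, f x = 0 -> f1 x != 0) -> (forall x, A <= x -> p x <= 0) ->
  has_ubound (zeros f).
Proof.
move=> [fd f1d] simple_zeros p0.
have zeros_unique x y : A <= x -> f x = 0 -> f y = 0 -> y <= x.
  move=> Ax fx fy; rewrite leNgt; apply/negP => xy.
  have [xi /andP[xxi xiy] E] := real_mean_value xy fd.
  have f1xi : f1 xi = 0.
    apply/eqP; move: E; rewrite fx fy subrr => /esym/eqP.
    by rewrite mulf_eq0 subr_eq0 (gt_eqF xy) orbF.
  pose g t := f t * f1 t.
  have gd t : is_derive t 1 g (f1 t ^+ 2 - p t * f t ^+ 2).
    apply: (is_derive_eq (is_derive_mul (fd t) (f1d t))); ring.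
  have g_incr s t : A <= s -> s < t -> g s <= g t.
    move=> As st; have [c /andP[sc _] Eg] := real_mean_value st gd.
    rewrite -subr_ge0 Eg mulr_ge0 ?subr_ge0 ?(ltW st) //.
    apply: le_trans (sqr_ge0 _); rewrite mulr_le0_ge0 ?sqr_ge0 // p0 //.
    exact: le_trans As (ltW sc).
  have [eta /andP[xeta etaxi] E2] := real_mean_value xxi (fun t =>
    is_derive_mul (fd t) (fd t)).
  have geta : g eta = 0.
    apply/eqP; rewrite eq_le.
    have := g_incr _ _ Ax xeta; have := g_incr _ _ (le_trans Ax (ltW xeta))
      etaxi.
    by rewrite /g f1xi fx mulr0 mul0r => -> ->.
  have fxi : f xi = 0.
    apply/eqP; rewrite -sqrf_eq0.
    move: E2; rewrite fx mul0r subr0 [f1 eta * _]mulrC -/(g eta) geta addr0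
      mul0r expr2 => ->.
    by rewrite eqxx.
  by have := simple_zeros xi fxi; rewrite f1xi eqxx.
have [[x Ax fx]|none] := pselect (exists2 x, A <= x & f x = 0).
  by exists x => y fy; exact: zeros_unique Ax fx fy.
exists A => y fy; rewrite leNgt; apply/negP => Ay.
by apply: none; exists y => //; exact: ltW.
Qed.

(** An accumulation point of zeros is also a limit of zeros of [f'], by Rolle's
    theorem, and so a double zero. *)
Lemma simple_zeros_finite f (f1 : R -> R) : (forall x, is_derive x 1 f (f1 x))
  ->
  continuous f1 -> (forall x, f x = 0 -> f1 x != 0) ->
  has_ubound (zeros f) -> has_lbound (zeros f) -> finite_set (zeros f).
Proof.
move=> fd f1c simple_zeros [b bub] [a alb]; apply: contrapT => inf.
have bnd : bounded_set (zeros f).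
  have [M [Mreal HM]] := compact_bounded (@segment_compact R a b).
  exists M; split=> // x Mx y fy; apply: HM Mx _ _.
  by rewrite /= in_itv /= alb // bub.
have [l lim_l] := infinite_bounded_limit_point_nonempty inf bnd.
have [fl|fl] := eqVneq (f l) 0; last first.
  have fc : {for l, continuous f} := is_derive_continuous (fd l).
  have [y [_ fy]] := lim_l _ (cvgr_neq0 _ fc fl).
  by rewrite /= fy eqxx.
have f1_near : \forall t \near l, f1 t != 0.
  exact: cvgr_neq0 (f1c l) (simple_zeros l fl).
have [e /= e0 He] := (nbhs_ballP _ _).1 f1_near.
have [y [yl fy yball]] := lim_l _ (nbhsx_ballx l e e0).
have key s t : s < t -> f s = 0 -> f t = 0 -> ball l e s -> ball l e t -> False.
  move=> st fs ft; rewrite /ball /= !ltr_distl => /andP[s1 s2] /andP[t1 t2].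
  have [c /andP[sc ct] E] := real_mean_value st fd.
  have : f1 c != 0.
    apply: He; rewrite /ball /= distrC ltr_distl; apply/andP; split; lra.
  move: E; rewrite fs ft subrr => /esym/eqP.
  by rewrite mulf_eq0 subr_eq0 (gt_eqF st) orbF => ->.
move: yl; rewrite neq_lt => /orP[yl|yl].
  exact: key yl fy fl yball (ballxx _ e0).
exact: key yl fl fy (ballxx _ e0) yball.
Qed.

Lemma zeros_reflect_ubound f :
  has_ubound (zeros (fun x => f (- x))) <-> has_lbound (zeros f).
Proof.
split=> -[M H]; exists (- M) => x fx.
  by rewrite lerNl; apply: H; rewrite /zeros /= opprK.
by rewrite -lerN2 opprK; apply: H.
Qed.

Lemma zeros_near_pinfty (q : {poly R}) f f1 :
  solves (fun x => q.[x]) f f1 -> (forall x, f x = 0 -> f1 x != 0) ->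
  has_ubound (zeros f) <-> lead_coef q <= 0.
Proof.
move=> sol simple_zeros; split=> [ub|lc].
  rewrite leNgt; apply/negP => lc; have [A HA] := poly_pinfty_gt_lc lc.
  exact: (oscillation sol lc HA ub).
suff [A HA] : exists A, forall x, A <= x -> q.[x] <= 0 by exact: nonoscillation
  sol simple_zeros HA.
have [lc0|lc0] := eqVneq (lead_coef q) 0.
  exists 0 => x _; move/eqP: lc0; rewrite lead_coef_eq0 => /eqP ->.
  by rewrite horner0.
have lcN : 0 < lead_coef (- q) by rewrite lead_coefN oppr_gt0 lt_neqAle lc0.
have [A HA] := poly_pinfty_gt_lc lcN; exists A => x /HA.
by rewrite hornerN => /(lt_le_trans lcN); rewrite oppr_gt0 => /ltW.
Qed.

Lemma zeros_near_minfty (q : {poly R}) f f1 :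
  solves (fun x => q.[x]) f f1 -> (forall x, f x = 0 -> f1 x != 0) ->
  has_lbound (zeros f) <-> (-1) ^+ (size q).-1 * lead_coef q <= 0.
Proof.
move=> sol simple_zeros; rewrite -zeros_reflect_ubound.
have := solves_reflect sol.
have -> : (fun x => q.[- x]) = (fun x => (q \Po (- 'X)).[x]).
  by apply/funext => x; rewrite horner_comp !hornerE.
move=> /zeros_near_pinfty ->; last first.
  by move=> x /simple_zeros; rewrite oppr_eq0.
by rewrite lead_coef_comp ?size_polyN ?size_polyX // lead_coefN lead_coefX
  mulrC.
Qed.

End sturm.

(** * Reduction to a real equation *)

Section restriction.
Variable R : realType.
Local Notation C := (cplx R).

Lemma horner_real (q : {poly R}) (x : R) :
  (map_poly (real_complex R) q : {poly C}).[x%:C%C] = (q.[x])%:C%C.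
Proof. exact: horner_map. Qed.

Lemma poly_real_uniqueness (q : {poly R}) (f f1 : R -> R) (x0 : R) :
  solves (fun x => q.[x]) f f1 -> f x0 = 0 -> f1 x0 = 0 ->
  forall x, f x = 0 /\ f1 x = 0.
Proof.
move=> [fd f1d] fx0 f1x0 x.
have [|B _ qB] := @bounded_on_disc R (fun z => (map_poly (real_complex R)
  q).[z]) x0%:C%C `|x - x0|.
  move=> z; exact: (is_derive_continuous (is_derive_horner _ z)).
apply: (@real_uniqueness R f f1 (fun x => q.[x]) x0 B x fd f1d _ fx0 f1x0) =>
  y yx.
rewrite -modulus_real -horner_real; apply: qB.
by rewrite -rmorphB modulus_real.
Qed.

Lemma is_derive_restrict (w : C -> C) (c d : C) (x : R) :
  is_derive (x%:C%C : C) 1 w d ->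
  is_derive x 1 (fun s : R => complex.Re (c * w s%:C%C)) (complex.Re (c * d)).
Proof.
move=> wd; have -> : (fun s : R => complex.Re (c * w s%:C%C)) =
    (fun s : R => complex.Re (c * w (0 + s%:C%C * 1))).
  by apply/funext => s; rewrite add0r mulr1.
rewrite -[in X in is_derive _ _ _ X](mulr1 d); apply: is_derive_line.
by rewrite add0r mulr1.
Qed.

Lemma solves_restrict (q : {poly R}) (w w1 : C -> C) (c : C) :
  (forall z : C, is_derive z 1 w (w1 z)) ->
  (forall z : C, is_derive z 1 w1 (- ((map_poly (real_complex R) q).[z] * w
    z))) ->
  solves (fun x => q.[x]) (fun x => complex.Re (c * w x%:C%C))
    (fun x => complex.Re (c * w1 x%:C%C)).
Proof.
move=> wd w1d; split=> x; first exact: is_derive_restrict.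
apply: (is_derive_eq (is_derive_restrict c (w1d x%:C%C))).
by rewrite horner_real -ReZ mulrN ReN mulrCA.
Qed.

(** The imaginary part of the normalised solution solves the same real equation
    with vanishing initial data at [x0]. *)
Lemma real_solution (q : {poly R}) (w w1 : C -> C) (x0 : R) :
  (forall z : C, is_derive z 1 w (w1 z)) ->
  (forall z : C, is_derive z 1 w1 (- ((map_poly (real_complex R) q).[z] * w
    z))) ->
  (exists z, w z != 0) -> w x0%:C%C = 0 ->
  exists f f1 : R -> R, [/\ solves (fun x => q.[x]) f f1,
    forall x, f x = 0 -> f1 x != 0 & forall x : R, w x%:C%C = 0 <-> f x = 0].
Proof.
move=> wd w1d [z wz] wx0.
have w1x0 : w1 x0%:C%C != 0.
  by apply/eqP => w1x0; move: wz; rewrite (complex_uniqueness wd w1d wx0 w1x0)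
    eqxx.
pose c := (w1 x0%:C%C)^-1.
have cw1 : c * w1 x0%:C%C = 1 by rewrite mulVf.
have sol := solves_restrict c wd w1d.
have sol_im := solves_restrict (- 'i%C * c) wd w1d.
have im0 x : complex.Re (- 'i%C * c * w x%:C%C) = 0.
  have [] // := poly_real_uniqueness sol_im (x0 := x0) _ _ x.
    by rewrite wx0 mulr0.
  by rewrite -mulrA cw1 mulr1 /= oppr0.
exists (fun x => complex.Re (c * w x%:C%C)),
  (fun x => complex.Re (c * w1 x%:C%C)).
split=> // x.
  move=> fx; apply/eqP => f1x.
  have [_] := poly_real_uniqueness sol fx f1x x0.
  by rewrite cw1 /= => /eqP; rewrite oner_eq0.
split=> [->|fx]; first by rewrite mulr0.
have c0 : c != 0 by rewrite invr_eq0.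
apply: (mulfI c0); rewrite mulr0.
move: (im0 x) fx; rewrite -mulrA; case: (c * w _) => a b /=.
rewrite oppr0 mul0r mulN1r opprK add0r => -> ->.
by [].
Qed.

Lemma finite_set_bounds (A : set R) :
  finite_set A -> has_ubound A /\ has_lbound A.
Proof.
move=> /finite_compact /compact_bounded [M [_ HM]].
have AM x : A x -> `|x| <= M + 1 by apply: HM; rewrite ltrDl.
split; [exists (M + 1)|exists (- (M + 1))] => x /AM; rewrite ler_norml.
  by case/andP.
by case/andP.
Qed.

End restriction.

Theorem theorem2 (R : realType) (P : {poly cplx R}) (w : cplx R -> cplx R)
    (P_real : real_poly P)
    (w_sol : entire_solution P w)
    (w_neq0 : exists z : cplx R, w z != 0)
    (w_real_roots : forall z : cplx R, root_set w z -> z \is Num.real) :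
  (poly_degree P = 0 %[mod 4] ->
     finite_set (root_set w) \/
     (~ has_ubound (real_trace (root_set w)) /\
      ~ has_lbound (real_trace (root_set w)))) /\
  (odd (poly_degree P) ->
     (exists L : set (cplx R), is_ray L /\ root_set w `<=` L) /\
     infinite_set (root_set w)).
Proof.
have [q Pq] : exists q : {poly R}, P = map_poly (real_complex R) q.
  exists (map_poly (@complex.Re R) P); apply/polyP => i.
  rewrite coef_map /= coef_map_id0 //; apply/esym/RRe_real.
  by move/polyOverP: P_real.
have degE : poly_degree P = (size q).-1 by rewrite /poly_degree Pq
  size_map_poly.
rewrite degE; case: w_sol => w_ent w1_ent eqw; rewrite Pq in eqw.
pose w1 := derive1 w.
have wd (z : cplx R) : is_derive z 1 w (w1 z).
  by rewrite /w1 derive1E; apply: derivableP; exact: w_ent.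
have w1d (z : cplx R) : is_derive z 1 w1 (- ((map_poly (real_complex R) q).[z]
  * w z)).
  have -> : - ((map_poly (real_complex R) q).[z] * w z) = derive1 w1 z.
    by apply/eqP; rewrite eq_sym -addr_eq0; apply/eqP; exact: eqw.
  by rewrite derive1E; apply: derivableP; exact: w1_ent.
have [[z0 wz0]|no_root] := pselect (exists z, w z = 0); last first.
  split=> [_|deg_odd].
    left; suff -> : root_set w = set0 by exact: finite_set0.
    by apply/seteqP; split=> z // wz; apply: no_root; exists z.
  have w0 z : w z != 0 by apply/eqP => wz; apply: no_root; exists z.
  by have := zero_free_even_degree wd w1d w0; rewrite size_map_poly deg_odd.
pose x0 := complex.Re z0.
have wx0 : w x0%:C%C = 0 by rewrite RRe_real //; exact: w_real_roots.
have [f [f1 [sol simple_zeros wf]]] := real_solution wd w1d w_neq0 wx0.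
have traceE : real_trace (root_set w) = zeros f.
  by apply/seteqP; split=> x; rewrite /real_trace /root_set /zeros /= wf.
have rootsE : root_set w = real_complex R @` zeros f.
  apply/seteqP; split=> [z wz|_ [x fx <-]]; last by rewrite /root_set /= wf.
  have zE := RRe_real (w_real_roots z wz).
  by exists (complex.Re z); [rewrite /zeros /= -wf zE|exact: zE].
have ubE := zeros_near_pinfty sol simple_zeros.
have lbE := zeros_near_minfty sol simple_zeros.
rewrite -signr_odd in lbE.
split=> [deg4|deg_odd].
  have deg_even : odd (size q).-1 = false.
    move: deg4; rewrite mod0n => /eqP/dvdnP[k ->].
    by rewrite oddM andbF.
  rewrite deg_even expr0 mul1r in lbE.
  rewrite traceE; have [lc|lc] := leP (lead_coef q) 0; last first.
    by right; split=> [/ubE|/lbE]; rewrite leNgt lc.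
  left; rewrite rootsE; apply: finite_image.
  apply: simple_zeros_finite sol.1 _ simple_zeros _ _.
  - by move=> x; exact: is_derive_continuous (sol.2 x).
  - exact/ubE.
  - exact/lbE.
rewrite deg_odd expr1 mulN1r oppr_le0 in lbE.
have fin_zeros : finite_set (root_set w) -> finite_set (zeros f).
  move=> fin; apply: (@sub_finite_set _ _ (@complex.Re R @` root_set w)).
    by move=> x fx; exists x%:C%C => //; rewrite rootsE; exists x.
  exact: finite_image.
have lc0 : lead_coef q != 0.
  by rewrite lead_coef_eq0; apply: contraTneq deg_odd => ->; rewrite size_poly0.
split.
  move: lc0; rewrite neq_lt => /orP[/ltW/ubE|/ltW/lbE] [c cb].
    exists (real_complex R @` `]-oo, c]); split; first by exists c; right.
    by rewrite rootsE; apply: image_subset => x /cb; rewrite /= in_itv.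
  exists (real_complex R @` `[c, +oo[); split; first by exists c; left.
  by rewrite rootsE; apply: image_subset => x /cb; rewrite /= in_itv /= andbT.
move=> /fin_zeros fin; move: lc0.
have [/ubE h1 /lbE h2] := finite_set_bounds fin.
by rewrite eq_le h1 h2.
Qed.
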